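(* Let $T$ be an expandable tree. Then there exists a tree-shift $\mathcal{T}\subseteq\{0,1\}^T$ such that $h(\mathcal{T})>0$ but $\mathcal{T}$ has no independence set with positive density (i.e. no independence set $S\subseteq T$ for which $d(S)$ exists and $d(S)>0$).
   Context: Trees. A tree $T$ is a countable, locally finite (connected) graph without loops (cycles), with a root $\epsilon$, whose vertices are represented as words over $d$ generators $g_1,\dots,g_d$: $T$ is a set of finite words over $\{g_1,\dots,g_d\}$ containing the empty word $\epsilon$ and closed under taking prefixes, with an edge from $g$ to $gg_i$ whenever both are in $T$. $T_n$ is the set of vertices of $T$ of length $n$ (at distance $n$ from $\epsilon$), and $\Delta_n=\bigcup_{i=0}^nT_i$. The expanding number of $T$ is $\gamma_T=\lim_{n\to\infty}|T_{n+1}|/|T_n|$, whenever this limit exists. $T$ is expandable if $\gamma_T$ exists and $\gamma_T>1$. Tree-shifts. For a finite alphabet $\mathcal{A}$, a labeled tree is a function $t:T\to\mathcal{A}$, written $t=(t_g)_{g\in T}$. A tree-shift $\mathcal{T}\subseteq\mathcal{A}^T$ is the set of all labeled trees that avoid every member of some given set of forbidden blocks, where a block is a labeling $p:F\to\mathcal{A}$ of a finite nonempty set $F$ of words over the generators, and $t$ avoids $p$ if there is no $g\in T$ with $gF\subseteq T$ and $t_{gh}=p_h$ for all $h\in F$. The entropy is $$h(\mathcal{T})=\limsup_{n\to\infty}\frac{\log|\mathcal{P}(\Delta_n,\mathcal{T})|}{|\Delta_n|},\qquad \mathcal{P}(\Delta_n,\mathcal{T})=\{(x_g)_{g\in\Delta_n}:x\in\mathcal{T}\}.$$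 Independence and density. $S\subseteq T$ is an independence set of $\mathcal{T}$ if for every $u\in\mathcal{A}^S$ there is $t\in\mathcal{T}$ with $t_g=u_g$ for all $g\in S$. The density of $S\subseteq T$ is $d(S)=\lim_{n\to\infty}|S\cap\Delta_n|/|\Delta_n|$ when the limit exists. *)

(* Defs.v *)
From HB Require Import structures.
From mathcomp Require Import all_boot all_order all_algebra finmap.
From mathcomp Require Import all_classical all_reals all_analysis.

Set Implicit Arguments.
Unset Strict Implicit.
Unset Printing Implicit Defensive.

Import Order.TTheory GRing.Theory Num.Theory.
Import numFieldNormedType.Exports.

Local Open Scope classical_set_scope.
Local Open Scope ring_scope.

Definition word (d : nat) := seq 'I_d.

(* The edges, from g to rcons g i whenever both words are in T, are determined
   by the vertex set. *)
Definition is_tree (d : nat) (T : set (word d)) : Prop :=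
  T [::] /\ forall g h : word d, T (g ++ h) -> T g.

(* Below, a set T of words is also used as the type of its elements (through
   the coercion set_type), so that a labeled tree is a function t : T -> A. *)

Definition level (d : nat) (T : set (word d)) (n : nat) : set T :=
  [set g : T | size (val g) = n].
Arguments level {d} T n _.

Definition Delta (d : nat) (T : set (word d)) (n : nat) : set T :=
  [set g : T | (size (val g) <= n)%N].
Arguments Delta {d} T n _.

(* Only meaningful for finite X: fset_set is empty on infinite sets.  The sets
   counted below are finite by finite_level, finite_Delta, finite_patterns. *)
Definition card (K : choiceType) (X : set K) : nat := #|` fset_set X |.

(* |T_{n+1}| / |T_n|, where x / 0 = 0: if T is finite the sequence is eventually
   0, so that T is not expandable. *)
Definition growth_ratio (R : realType) (d : nat) (T : set (word d)) : R^nat :=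
  fun n => (card (level T n.+1))%:R / (card (level T n))%:R.

Definition expandable (R : realType) (d : nat) (T : set (word d)) : Prop :=
  exists gamma : R, growth_ratio R T @ \oo --> gamma /\ 1 < gamma.

Record block (d : nat) (A : finType) := Block {
  shape : {fset word d};
  shape_neq0 : shape != fset0;
  labels : shape -> A
}.

Definition occurs (d : nat) (A : finType) (T : set (word d))
    (p : block d A) (t : T -> A) : Prop :=
  exists (g : T) (gF : forall h : shape p, val g ++ val h \in T),
    forall h : shape p, t (exist _ (val g ++ val h) (gF h)) = labels h.

Definition is_tree_shift (d : nat) (A : finType) (T : set (word d))
    (TS : set (T -> A)) : Prop :=
  exists forbidden : set (block d A),
    TS = [set t | forall p, forbidden p -> ~ occurs p t].

Definition patterns (d : nat) (A : finType) (T : set (word d))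
    (D : set T) (TS : set (T -> A)) : set (D -> A) :=
  [set (fun g : D => x (val g)) | x in TS].
Arguments patterns {d A T} D TS _.

(* The limsup is taken in the extended reals.  Since ln 0 = 0, the empty
   tree-shift gets entropy 0. *)
Definition entropy (R : realType) (d : nat) (A : finType) (T : set (word d))
    (TS : set (T -> A)) : \bar R :=
  limn_esup (fun n => (ln ((card (patterns (Delta T n) TS))%:R : R)
                       / (card (Delta T n))%:R)%:E).

Definition independence_set (d : nat) (A : finType) (T : set (word d))
    (TS : set (T -> A)) (S : set T) : Prop :=
  forall u : S -> A, exists t : T -> A, TS t /\ forall g : S, t (val g) = u g.

Definition has_density (R : realType) (d : nat) (T : set (word d))
    (S : set T) (r : R) : Prop :=
  (fun n => (card (S `&` Delta T n))%:R / (card (Delta T n))%:R : R) @ \oo --> r.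

Lemma finite_Delta (d : nat) (T : set (word d)) (n : nat) :
  finite_set (Delta T n).
Proof.
pose W := [set w : word d | (size w <= n)%N].
have finW : finite_set W.
  pose f (x : {k : 'I_n.+1 & k.-tuple 'I_d}) : word d := val (tagged x).
  apply: (@sub_finite_set _ _ (f @` setT)); last first.
    by apply: finite_image; exact: finite_finset.
  move=> w Ww.
  have k : (size w < n.+1)%N by [].
  by exists (Tagged (fun k : 'I_n.+1 => k.-tuple 'I_d)
    (in_tuple w : (Ordinal k).-tuple 'I_d)).
have -> : Delta T n = val @^-1` W by [].
by apply: finite_preimage => // x y _ _; exact: val_inj.
Qed.

Lemma finite_level (d : nat) (T : set (word d)) (n : nat) :
  finite_set (level T n).
Proof.
by apply: sub_finite_set (finite_Delta T n) => g /= <-; rewrite /Delta /=.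
Qed.

Lemma finite_patterns (d : nat) (A : finType) (T : set (word d)) (n : nat)
    (TS : set (T -> A)) :
  finite_set (patterns (Delta T n) TS).
Proof.
pose D := fset_set (Delta T n).
have inD (g : Delta T n) : val g \in D.
  by rewrite in_fset_set ?(valP g) //; exact: finite_Delta.
pose f (u : {ffun D -> A}) : Delta T n -> A := fun g => u [` inD g]%fset.
apply: (@sub_finite_set _ _ (f @` setT)); last first.
  by apply: finite_image; exact: finite_finset.
move=> _ [x _ <-]; exists [ffun g : D => x (val g)] => //.
by apply/funext => g; rewrite /f ffunE.
Qed.

(* Main.v *)
From Pilot Require Import Defs.
From mathcomp Require Import all_boot all_order all_algebra finmap.
From mathcomp Require Import all_classical all_reals all_analysis.
From mathcomp Require Import lra.
Import Pilot.Defs.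

Import Order.TTheory GRing.Theory Num.Theory.
Import numFieldNormedType.Exports.

Local Open Scope classical_set_scope.
Local Open Scope ring_scope.

(** The tree-shift consists of the labelings whose 1s all lie at one depth; it is
    obtained by forbidding two 1s at different depths.

    Entropy. Every 0-1 labeling of T_n extends by 0 to a point of the shift
    ([card_patterns_one_level]), so Delta_n carries at least 2^|T_n| patterns.
    Eventually the levels grow at a rate at least q for some q > 1, so |Delta_n|
    is, up to a constant, at most a geometric sum with last term |T_n|; hence T_n
    fills a positive proportion of Delta_n ([level_proportion]), which bounds the entropy below
    by a positive multiple of ln 2.

    Independence. If S is an independence set, some point of the shift is 1 on
    all of S, so S lies in a single level ([one_level_independence_set]). Levels
    are finite while |Delta_n| tends to infinity, so the density of S cannot be
    positive ([density_one_level]). The positive entropy is thus carried by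
    levels that vary with n and cannot be made independent simultaneously. *)

Lemma card_le (K : choiceType) (X Y : set K) :
  finite_set Y -> X `<=` Y -> (card X <= card Y)%N.
Proof.
move=> finY XY; apply: fsubset_leq_card.
by rewrite -fset_set_sub //; exact: sub_finite_set finY.
Qed.

Lemma card_DeltaS (d : nat) (T : set (word d)) (n : nat) :
  card (Delta T n.+1) = (card (Delta T n) + card (level T n.+1))%N.
Proof.
have finD := finite_Delta T n; have finL := finite_level T n.+1.
have -> : Delta T n.+1 = Delta T n `|` level T n.+1.
  apply/seteqP; split=> g /=; rewrite /Delta /level /=.
    by rewrite leq_eqVlt ltnS => /orP[/eqP|]; [right | left].
  by case=> [/leqW | ->].
rewrite /card fset_setU // -cardfsUI.
suff -> : (fset_set (Delta T n) `&` fset_set (level T n.+1) = fset0)%fset.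
  by rewrite cardfs0 addn0.
apply/eqP; rewrite fsetI_eq0; apply/fdisjointP => g.
rewrite !in_fset_set // inE => gD; apply/negP; rewrite inE => gL.
by move: gD; rewrite /Delta /= gL ltnn.
Qed.

Section Growth.
Context {R : realType} {d : nat} {T : set (word d)}.

Lemma expandable_level_growth : expandable R T ->
  exists q : R, 1 < q /\
    \forall n \near \oo, (0 < card (level T n))%N /\
      q * (card (level T n))%:R <= (card (level T n.+1))%:R.
Proof.
case=> gamma [cvg_ratio gamma_gt1].
pose q : R := (1 + gamma) / 2.
have q_gt1 : 1 < q by rewrite /q; lra.
exists q; split=> //.
have : \forall n \near \oo, q < growth_ratio R T n.
  by apply: cvgr_gt cvg_ratio _ _; rewrite /q; lra.
apply: filterS => n; rewrite /growth_ratio => q_lt.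
have level_gt0 : (0 < card (level T n))%N.
  rewrite lt0n; apply/eqP => level0.
  by move: q_lt; rewrite level0 invr0 mulr0; lra.
by split=> //; rewrite -ler_pdivlMr ?ltr0n // ltW.
Qed.

(** Write a_n = |T_n| and s_n = |Delta_n|. An inequality s_n <= C a_n passes to
    n + 1 because s_(n+1) = s_n + a_(n+1) <= (C / q + 1) a_(n+1), provided that
    C / q + 1 <= C, that is q / (q - 1) <= C. *)
Lemma level_proportion : expandable R T ->
  exists c : R, 0 < c /\
    \forall n \near \oo, (0 < card (Delta T n))%N /\
      c * (card (Delta T n))%:R <= (card (level T n))%:R.
Proof.
case/expandable_level_growth=> q [q_gt1 [N _ growth]].
have level_gt0 n : (N <= n)%N -> (0 < card (level T n))%N.
  by move=> /growth [].
(* The first term starts the induction at N, the second makes the induction step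
   work. *)
pose C : R := (card (Delta T N))%:R / (card (level T N))%:R + q / (q - 1).
have C_ge : q / (q - 1) <= C by rewrite /C lerDr divr_ge0.
have C_gt0 : 0 < C by apply: lt_le_trans C_ge; apply: divr_gt0; lra.
have Delta_le k : (card (Delta T (N + k)))%:R <= C * (card (level T (N + k)))%:R.
  elim: k => [|k IHk].
    rewrite addn0 /C mulrDl divfK; last by rewrite pnatr_eq0 -lt0n level_gt0.
    by rewrite lerDl mulr_ge0 // divr_ge0 //; lra.
  rewrite addnS card_DeltaS natrD.
  have [_ le_q] := growth (N + k)%N (leq_addr _ _).
  have : q <= C * (q - 1) by rewrite -ler_pdivrMr //; lra.
  move: IHk le_q; set a := (card (level T (N + k)))%:R.
  set b := (card (level T (N + k).+1))%:R; set s := (card _)%:R.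
  move=> s_le le_q q_le.
  have Ca_le : C * (q * a) <= C * b by rewrite ler_pM2l.
  have b_ge0 : 0 <= b by [].
  rewrite -(@ler_pM2l _ q) //; last by lra.
  nra.
exists C^-1; rewrite invr_gt0; split=> //; exists N => // n /= Nn; split.
  apply: leq_trans (level_gt0 n Nn) _; apply: card_le (finite_Delta T n) _.
  by move=> g /= <-; rewrite /Delta /=.
by rewrite ler_pdivrMl //; have := Delta_le (n - N)%N; rewrite subnKC.
Qed.

Lemma card_Delta_unbounded : expandable R T ->
  forall m : nat, \forall n \near \oo, (m <= card (Delta T n))%N.
Proof.
case/expandable_level_growth=> q [_ [N _ growth]] m.
exists (N + m)%N => // n /= le_n.
have Delta_ge k : (k <= card (Delta T (N + k)))%N.
  elim: k => [//|k IHk]; rewrite addnS card_DeltaS -addn1 leq_add //.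
  by case: (growth (N + k).+1) => //=; rewrite leqW ?leq_addr.
have /subnKC <- : (N <= n)%N by exact: leq_trans (leq_addr _ _) le_n.
by apply: leq_trans (Delta_ge _); rewrite leq_subRL // (leq_trans (leq_addr _ _) le_n).
Qed.

End Growth.

Definition one_level_shift (d : nat) (T : set (word d)) : set (T -> bool) :=
  [set t | forall g h : T, t g -> t h -> size (val g) = size (val h)].

Section OneLevelShift.
Context {d : nat} {T : set (word d)}.

(** A block is matched at every vertex k of T, but prefixing k preserves
    differences of depth, so no block with two 1s at different depths occurs in
    a labeling of the shift; conversely, a violating pair g, h already spells
    out such a block at the root. *)
Lemma is_tree_shift_one_level : is_tree T -> is_tree_shift (@one_level_shift d T).
Proof.
case=> T_root _.
exists [set p : block d bool | exists g h : shape p,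
  [/\ size (val g) != size (val h), labels g & labels h]].
apply/seteqP; split=> [t t_one p [g [h [size_neq lg lh]]] [k [kF occ]]|t avoid g h tg th].
  have := t_one (exist _ (val k ++ val g) (kF g)) (exist _ (val k ++ val h) (kF h)).
  rewrite !occ => /(_ lg lh) /= /eqP.
  by rewrite !size_cat eqn_add2l (negPf size_neq).
apply/eqP; apply/negPn/negP => size_neq.
pose F : {fset word d} := [fset val g; val h]%fset.
have gF : val g \in F by rewrite !inE eqxx.
have hF : val h \in F by rewrite !inE eqxx orbT.
have F_neq0 : F != fset0 by apply/fset0Pn; exists (val g).
apply: (avoid (@Block d bool F F_neq0 (fun=> true))).
  by exists [` gF]%fset, [` hF]%fset.
have inT (k : F) : [::] ++ val k \in T.
  by rewrite /=; have := valP k; rewrite !inE => /orP[]/eqP ->; rewrite -in_setE; exact: valP.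
exists (exist _ ([::] : word d) (mem_set T_root)), inT => k /=.
have : val k = val g \/ val k = val h.
  by have := valP k; rewrite !inE => /orP[]/eqP; [left | right].
case=> Ek.
- by rewrite (_ : exist _ _ _ = g) //; exact: val_inj.
- by rewrite (_ : exist _ _ _ = h) //; exact: val_inj.
Qed.

Lemma card_patterns_one_level (n : nat) :
  (2 ^ card (level T n) <= card (patterns (Delta T n) (@one_level_shift d T)))%N.
Proof.
pose L := fset_set (level T n); have finL := finite_level T n.
pose restr (B : {fset T}) : Delta T n -> bool := fun g => val g \in B.
have restr_inj : {in fpowerset L &, injective restr}.
  move=> A B; rewrite !fpowersetE => /fsubsetP AL /fsubsetP BL eqAB.
  apply/fsetP => g; have [gD|gD] := boolP (g \in Delta T n).
    by have := congr1 (fun r => r (exist _ g gD)) eqAB.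
  (* A vertex outside Delta_n is invisible to [restr], and lies outside L as well,
     hence outside A and B. *)
  have gL : g \notin L.
    apply: contra gD; rewrite in_fset_set // !inE /level /Delta /= => ->.
    exact: leqnn.
  by rewrite (contraNF (AL g) gL) (contraNF (BL g) gL).
rewrite -card_fpowerset -(card_in_imfset imfset_key restr_inj).
apply: fsubset_leq_card; apply/fsubsetP => _ /imfsetP[B /= + ->].
rewrite fpowersetE => /fsubsetP BL.
rewrite in_fset_set; last exact: finite_patterns.
have BlevelE g : g \in B -> size (val g) = n.
  by move=> /BL; rewrite in_fset_set // inE.
apply/mem_set; exists (fun g => g \in B) => // g h gB hB.
by rewrite (BlevelE g) // (BlevelE h).
Qed.

(** A point of the shift that is 1 on all of S confines S to the one level where
    that point has its 1s. *)
Lemma one_level_independence_set (S : set T) :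
  independence_set (@one_level_shift d T) S -> exists n, S `<=` level T n.
Proof.
move=> indep; have [t [t_one tS]] := indep (fun=> true).
have t1 g : S g -> t g.
  by move=> Sg; have := tS (exist _ g (mem_set Sg)) => /= ->.
have [[g Sg]|S0] := pselect (exists g, S g); last first.
  by exists 0%N => g Sg; exfalso; apply: S0; exists g.
by exists (size (val g)) => h Sh; apply: t_one; exact: t1.
Qed.

Lemma entropy_one_level_gt0 (R : realType) :
  expandable R T -> (0 < entropy R (@one_level_shift d T))%E.
Proof.
case/level_proportion=> c [c_gt0 c_le].
have ln2_gt0 : 0 < ln (2 : R) by rewrite ln_gt0 // ltr1n.
apply: (@lt_le_trans _ _ (c * ln 2)%:E); first by rewrite lte_fin mulr_gt0.
rewrite /entropy limn_esup_lim; apply: lime_ge; first exact: is_cvg_esups.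
apply: filterS c_le => n [Delta_gt0 c_le].
apply: le_ereal_sup_tmp; eexists; first by exists n => /=.
rewrite lee_fin ler_pdivlMr ?ltr0n // mulrAC.
apply: (@le_trans _ _ ((card (level T n))%:R * ln 2)).
  by rewrite ler_pM2r.
rewrite mulr_natl -lnXn // -natrX.
have le_card := card_patterns_one_level n.
by rewrite ler_ln ?ler_nat // posrE ltr0n ?expn_gt0 // (leq_trans _ le_card) ?expn_gt0.
Qed.

End OneLevelShift.

Lemma density_one_level (R : realType) (d : nat) (T : set (word d))
    (S : set T) (m : nat) (r : R) :
  expandable R T -> S `<=` level T m -> has_density S r -> r <= 0.
Proof.
move=> expT S_level dens; rewrite leNgt; apply/negP => r_gt0.
(* If |Delta_n| is at least K, then |T_m| / |Delta_n| is below r / 2. *)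
pose K := (Num.truncn ((card (level T m))%:R / (r / 2))).+1.
have : \forall n \near \oo, r / 2 < (card (S `&` Delta T n))%:R / (card (Delta T n))%:R.
  by apply: cvgr_gt dens _ _; lra.
move=> ev; near \oo => n.
have K_le : (K <= card (Delta T n))%N.
  by near: n; exact: (card_Delta_unbounded expT).
have Delta_gt0 : (0 < card (Delta T n))%N by exact: leq_trans K_le.
have : r / 2 < (card (S `&` Delta T n))%:R / (card (Delta T n))%:R by near: n.
rewrite ltr_pdivlMr ?ltr0n //; apply/negP; rewrite -leNgt.
apply: (@le_trans _ _ (card (level T m))%:R).
  by rewrite ler_nat card_le //; [exact: finite_level | move=> g [/S_level]].
rewrite -ler_pdivrMl; last by lra.
rewrite mulrC; apply: (@le_trans _ _ K%:R); last by rewrite ler_nat.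
by apply: ltW; exact: truncnS_gt.
Unshelve. all: by end_near.
Qed.

Theorem theorem1p4 (R : realType) (d : nat) (T : set (word d))
    (hT : is_tree T) (hexp : expandable R T) :
  exists TS : set (T -> bool),
    [/\ is_tree_shift TS,
        (0 < entropy R TS)%E
      & ~ exists S : set T,
          independence_set TS S /\ exists r : R, has_density S r /\ 0 < r].
Proof.
exists (@one_level_shift d T); split.
- exact: is_tree_shift_one_level.
- exact: entropy_one_level_gt0.
- case=> S [/one_level_independence_set [m S_level] [r [dens]]].
  by apply/negP; rewrite -leNgt; exact: density_one_level hexp S_level dens.
Qed.
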